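(* Let $f:[0,1]\to\mathbb{R}$ be continuous and even with respect to the midpoint, i.e. $f(y)=f(1-y)$ for all $y\in[0,1]$. Then for any continuous function $\varphi:\mathbb{R}\to\mathbb{R}$, $$\big\langle\,(\varphi\circ f)\cdot[\![f]\!]\,\big\rangle=0 .$$
   Context: For a continuous function $g:[0,1]\to\mathbb{R}$ define its average $\langle g\rangle:=\int_0^1 g(y)\,dy$, its fluctuating part $\{g\}(y):=g(y)-\langle g\rangle$, and the function $$[\![g]\!](y):=\int_0^y\{g\}(\xi)\,d\xi-\int_0^1\int_0^\tau\{g\}(\xi)\,d\xi\,d\tau .$$ *)

(* Defs.v *)
(** Concrete real numbers of the standard library, with Coquelicot's Riemann
    integral.  A function on [0,1] is represented by a total function [R -> R];
    only its values on [0,1] matter, both in the hypotheses of the theorem and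
    in the operators below when [y] lies in [0,1]. *)
From Stdlib Require Import Reals.
From Coquelicot Require Import Coquelicot.
Open Scope R_scope.

Definition I01 (y : R) : Prop := 0 <= y <= 1.

Definition average (g : R -> R) : R := RInt g 0 1.

Definition fluct (g : R -> R) (y : R) : R := g y - average g.

(** The zero-average primitive of [fluct g]. *)
Definition dbracket (g : R -> R) (y : R) : R :=
  RInt (fluct g) 0 y - RInt (fun tau => RInt (fluct g) 0 tau) 0 1.

(* Main.v *)
Require Import Defs.
From Stdlib Require Import Reals Lra.
From Coquelicot Require Import Coquelicot.
Open Scope R_scope.

(** The reflection [y -> 1 - y] fixes [fluct f], which has zero average, so the
    primitive of [fluct f] vanishing at [0] is odd about [1/2].  It therefore
    averages to zero and equals [dbracket f].  The product of [dbracket f] with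
    the even function [phi o f] is odd about [1/2], so its average vanishes. *)

Lemma continuous_ex_RInt (g : R -> R) (a b : R) :
  (forall x, continuous g x) -> ex_RInt g a b.
Proof. intros Hg; apply (ex_RInt_continuous (V := R_CompleteNormedModule)); auto. Qed.

(** By the fundamental theorem of calculus the primitive has derivative [g x] at [x], hence is
    continuous there. *)
Lemma continuous_RInt_upper (g : R -> R) (a x : R) :
  (forall y, continuous g y) -> continuous (RInt g a) x.
Proof.
  intros Hg; apply (ex_derive_continuous (V := R_NormedModule)).
  exists (g x); apply (is_derive_RInt (V := R_CompleteNormedModule)) with a; [|apply Hg].
  apply filter_forall; intros y.
  apply (RInt_correct (V := R_CompleteNormedModule)), continuous_ex_RInt, Hg.
Qed.

Lemma RInt_reflect (g : R -> R) (a b : R) :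
  (forall x, continuous g x) ->
  RInt (fun y => g (1 - y)) a b = RInt g (1 - b) (1 - a).
Proof.
  intros Hg.
  assert (H := RInt_comp_lin (V := R_CompleteNormedModule) g (-1) 1 a b
                 (continuous_ex_RInt _ _ _ Hg)).
  replace (-1 * a + 1) with (1 - a) in H by ring.
  replace (-1 * b + 1) with (1 - b) in H by ring.
  (* The substitution gives bounds from [1 - a] to [1 - b] and a factor [-1]; swapping the bounds
     absorbs that factor. *)
  rewrite <- (opp_RInt_swap (V := R_CompleteNormedModule) g (1 - a) (1 - b))
    by now apply continuous_ex_RInt.
  rewrite <- H.
  rewrite <- (RInt_opp (V := R_CompleteNormedModule)).
  - apply RInt_ext; intros y _.
    replace (-1 * y + 1) with (1 - y) by ring.
    unfold opp, scal; simpl; unfold mult; simpl; ring.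
  - apply (ex_RInt_comp_lin (V := R_NormedModule) g (-1) 1).
    now apply continuous_ex_RInt.
Qed.

(** Reflection preserves the integral over [0,1], while oddness about 1/2 negates it, so the average
    equals its own opposite. *)
Lemma average_odd (h : R -> R) :
  (forall x, continuous h x) -> (forall y, h (1 - y) = - h y) -> average h = 0.
Proof.
  intros Hc Hodd; unfold average.
  assert (H := RInt_reflect h 0 1 Hc).
  replace (1 - 1) with 0 in H by ring; replace (1 - 0) with 1 in H by ring.
  rewrite (RInt_ext _ (fun y => opp (h y))) in H by (intros; apply Hodd).
  rewrite (RInt_opp (V := R_CompleteNormedModule)) in H by now apply continuous_ex_RInt.
  unfold opp in H; simpl in H; lra.
Qed.

Lemma continuous_fluct (g : R -> R) (x : R) :
  continuous g x -> continuous (fluct g) x.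
Proof.
  intros Hg; apply (continuous_minus (V := R_NormedModule)); [exact Hg|].
  apply continuous_const.
Qed.

(** By symmetry the integral over [0,y] equals that over [1-y,1], which complements the one over
    [0,1-y] to the total integral zero. *)
Lemma RInt_fluct_reflect (g : R -> R) (y : R) :
  (forall x, continuous g x) -> (forall y, g (1 - y) = g y) ->
  RInt (fluct g) 0 (1 - y) = - RInt (fluct g) 0 y.
Proof.
  intros Hc Heven.
  assert (Hf : forall x, continuous (fluct g) x) by (intros; apply continuous_fluct, Hc).
  assert (Hi : forall a b, ex_RInt (fluct g) a b) by (intros; now apply continuous_ex_RInt).
  assert (Htot : RInt (fluct g) 0 1 = 0).
  { unfold fluct.
    rewrite (RInt_minus (V := R_CompleteNormedModule));
      [|now apply continuous_ex_RInt|apply ex_RInt_const].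
    rewrite RInt_const; unfold average, minus, plus, opp, scal; simpl.
    unfold mult; simpl; ring. }
  assert (Href := RInt_reflect (fluct g) 0 y Hf).
  rewrite (RInt_ext _ (fluct g)) in Href
    by (intros z _; unfold fluct; now rewrite Heven).
  replace (1 - 0) with 1 in Href by ring.
  assert (Hch := RInt_Chasles (V := R_CompleteNormedModule) (fluct g) 0 (1 - y) 1
                   (Hi _ _) (Hi _ _)).
  unfold plus in Hch; simpl in Hch; lra.
Qed.

Lemma dbracket_even (g : R -> R) (y : R) :
  (forall x, continuous g x) -> (forall y, g (1 - y) = g y) ->
  dbracket g y = RInt (fluct g) 0 y.
Proof.
  intros Hc Heven; unfold dbracket.
  change (RInt (fun tau => RInt (fluct g) 0 tau) 0 1) with (average (RInt (fluct g) 0)).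
  rewrite average_odd; [ring| |].
  - intros; apply continuous_RInt_upper; intros; apply continuous_fluct, Hc.
  - intros; now apply RInt_fluct_reflect.
Qed.

(** The result for functions continuous and symmetric on all of R, where no integral needs a side
    condition on its bounds. *)
Lemma average_comp_dbracket_even (g phi : R -> R) :
  (forall x, continuous g x) -> (forall y, g (1 - y) = g y) ->
  (forall x, continuous phi x) ->
  average (fun y => phi (g y) * dbracket g y) = 0.
Proof.
  intros Hc Heven Hphi; apply average_odd.
  - intros x; apply (continuous_mult (K := R_AbsRing)).
    + apply continuous_comp; auto.
    (* [dbracket g] agrees everywhere with a plain primitive, whose continuity is known. *)
    + apply continuous_ext with (RInt (fluct g) 0).
      * intros y; symmetry; now apply dbracket_even.
      * apply continuous_RInt_upper; intros; apply continuous_fluct, Hc.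
  - intros y; rewrite !dbracket_even, Heven, RInt_fluct_reflect by assumption; ring.
Qed.

Lemma RInt_ext_I01 (g h : R -> R) (y : R) :
  I01 y -> (forall x, I01 x -> g x = h x) -> RInt g 0 y = RInt h 0 y.
Proof.
  unfold I01; intros Hy Heq; apply RInt_ext.
  rewrite Rmin_left, Rmax_right by lra; intros x Hx; apply Heq; lra.
Qed.

Lemma dbracket_ext_I01 (g h : R -> R) (y : R) :
  I01 y -> (forall x, I01 x -> g x = h x) -> dbracket g y = dbracket h y.
Proof.
  intros Hy Heq; unfold dbracket.
  assert (H1 : I01 1) by (unfold I01; lra).
  assert (Hfl : forall x, I01 x -> fluct g x = fluct h x).
  { intros x Hx; unfold fluct, average.
    now rewrite Heq, (RInt_ext_I01 g h). }
  f_equal.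
  - now apply RInt_ext_I01.
  - apply RInt_ext_I01; [exact H1|]; intros; now apply RInt_ext_I01.
Qed.

(** The nearest-point projection of R onto [0,1]. It commutes with the reflection, so composing with
    it turns symmetry on [0,1] into symmetry on R. *)
Definition clamp01 (y : R) : R := Rmax 0 (Rmin 1 y).

Lemma clamp01_I01 (y : R) : I01 (clamp01 y).
Proof. unfold clamp01, I01, Rmax, Rmin; repeat destruct Rle_dec; lra. Qed.

Lemma clamp01_id (y : R) : I01 y -> clamp01 y = y.
Proof. unfold clamp01, I01, Rmax, Rmin; repeat destruct Rle_dec; lra. Qed.

Lemma clamp01_reflect (y : R) : clamp01 (1 - y) = 1 - clamp01 y.
Proof. unfold clamp01, Rmax, Rmin; repeat destruct Rle_dec; lra. Qed.

Lemma clamp01_lipschitz (x y : R) :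
  Rabs (clamp01 y - clamp01 x) <= Rabs (y - x).
Proof.
  unfold clamp01, Rmax, Rmin, Rabs; repeat destruct Rle_dec; repeat destruct Rcase_abs; lra.
Qed.

Lemma continuous_comp_clamp01 (f : R -> R) (x : R) :
  continuous_on I01 f -> continuous (fun y => f (clamp01 y)) x.
Proof.
  intros Hf P HP.
  (* The radius [d] found at [clamp01 x] also serves at [x], since [clamp01] does not increase
     distances. *)
  destruct (Hf _ (clamp01_I01 x) P HP) as [d Hd].
  exists d; intros y Hy; apply Hd; [|apply clamp01_I01].
  unfold ball in *; simpl in *; unfold AbsRing_ball, abs, minus, plus, opp in *; simpl in *.
  eapply Rle_lt_trans; [apply clamp01_lipschitz|exact Hy].
Qed.

Theorem proposition4 (f : R -> R)
  (f_cont : continuous_on I01 f)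
  (f_even : forall y : R, I01 y -> f y = f (1 - y))
  (phi : R -> R)
  (phi_cont : forall x : R, continuous phi x) :
  average (fun y => phi (f y) * dbracket f y) = 0.
Proof.
  (* Only the values on [0,1] matter, so [f] may be extended continuously to R by constants. *)
  set (g := fun y => f (clamp01 y)).
  assert (Hfg : forall y, I01 y -> f y = g y)
    by (intros y Hy; unfold g; now rewrite clamp01_id).
  (* The right-hand [0] becomes the average built from [g]; it remains to compare two integrands on
     [0,1]. *)
  rewrite <- (average_comp_dbracket_even g phi).
  - apply RInt_ext_I01; [unfold I01; lra|].
    intros y Hy; now rewrite (dbracket_ext_I01 f g), Hfg.
  - intros x; now apply continuous_comp_clamp01.
  - intros y; unfold g; rewrite clamp01_reflect; symmetry; apply f_even, clamp01_I01.
  - exact phi_cont.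
Qed.
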